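(* Let $X$, $Y$ be real Banach spaces. Let $\varphi$ be a normalization function, let $A:Y\to Y^*$ be a (single-valued) duality mapping on $Y$ corresponding to $\varphi$, and suppose that its potential $\psi:Y\to\mathbb{R}$, $\psi(u)=\int_0^{\|u\|}\varphi(t)\,dt$, is continuously Gâteaux differentiable. Assume that $f:X\to Y$ is a $C^1$-mapping such that: (1) for any $y\in Y$ the functional $h:X\to\mathbb{R}$ given by $h(x)=\psi(f(x)-y)$ satisfies the Palais-Smale condition; (2) $f'(x)\in\operatorname{Isom}(X,Y)$ for any $x\in X$. Then $f$ is a diffeomorphism.
   Context: $C^1$ means continuously Fréchet differentiable (equivalently, continuously Gâteaux differentiable). A normalization function is a continuous, strictly increasing function $\varphi:\mathbb{R}_+\to\mathbb{R}_+$ with $\varphi(0)=0$ and $\varphi(r)\to\infty$ as $r\to\infty$, where $\mathbb{R}_+=[0,\infty)$. The duality mapping on a Banach space $E$ corresponding to $\varphi$ is the set-valued operator $A:E\to 2^{E^*}$, $$A(u)=\{u^*\in E^*:\ \|u^*\|_*=\varphi(\|u\|),\ \langle u^*,u\rangle=\|u^*\|_*\|u\|\}.$$ It coincides with the convex subdifferential of $\psi(u)=\int_0^{\|u\|}\varphi(t)\,dt$, which is called its potential. Writing $A:E\to E^*$ means that $A(u)$ is a singleton for every $u$, identified with its unique element. $f'(x)\in\operatorname{Isom}(X,Y)$ means that the continuous linear operator $f'(x):X\to Y$ is surjective and there is a constant $\alpha_x>0$ such that $\|f'(x)h\|\ge \alpha_x\|h\|$ for all $h\in X$. A Gâteaux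 differentiable functional $J:E\to\mathbb{R}$ on a Banach space $E$ satisfies the Palais-Smale condition if every sequence $(u_n)$ in $E$ such that $(J(u_n))$ is bounded and $J'(u_n)\to 0$ (in $E^*$) has a (norm-)convergent subsequence. A continuously Fréchet differentiable map $f:X\to Y$ is called a diffeomorphism if it is a bijection and its inverse $f^{-1}:Y\to X$ is continuously Fréchet differentiable as well. *)

(* Defs.v *)
From mathcomp Require Import all_boot all_order all_algebra.
From mathcomp Require Import all_classical all_reals all_analysis.

Set Implicit Arguments.
Unset Strict Implicit.
Unset Printing Implicit Defensive.

Import Order.TTheory GRing.Theory Num.Theory.
Import numFieldNormedType.Exports.

Local Open Scope classical_set_scope.
Local Open Scope ring_scope.

Section Defs.
Context {R : realType}.

Section Operators.
Context {E F : normedModType R}.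

(* The norm of L(E, F), and of E^* when F = R. Being a real supremum, it is
   meaningful only when the continuous linear map L is bounded on the unit ball,
   i.e. when L is linear and continuous. *)
Definition opnorm (L : E -> F) : R :=
  sup [set `|L h| | h in [set h : E | `|h| <= 1]].

Definition opnorm_continuous (D : E -> E -> F) : Prop :=
  forall x, opnorm (fun v => D z v - D x v) @[z --> x] --> (0 : R).

Definition is_C1 (f : E -> F) : Prop :=
  (forall x, differentiable f x) /\
  opnorm_continuous (fun x => 'd f x : E -> F).

Definition gateaux_derivative (f : E -> F) (x v : E) : F := 'D_v f x.

Definition gateaux_differentiable (f : E -> F) (x : E) : Prop :=
  [/\ forall v, derivable f x v,
      linear (gateaux_derivative f x) &
      continuous (gateaux_derivative f x)].

Definition continuously_gateaux_differentiable (f : E -> F) : Prop :=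
  (forall x, gateaux_differentiable f x) /\
  opnorm_continuous (gateaux_derivative f).

Definition Isom (L : E -> F) : Prop :=
  (forall y, exists x, L x = y) /\
  exists2 alpha : R, 0 < alpha & forall h, alpha * `|h| <= `|L h|.

End Operators.

Definition diffeomorphism {E F : normedModType R} (f : E -> F) : Prop :=
  is_C1 f /\ exists g : F -> E, [/\ cancel f g, cancel g f & is_C1 g].

Definition dual {E : normedModType R} : set (E -> R^o) :=
  [set l : E -> R^o | linear l /\ continuous l].

(* phi is a function on [0, +oo[; its values at negative reals are irrelevant. *)
Definition normalization_function (phi : R -> R) : Prop :=
  [/\ forall r, 0 <= r -> 0 <= phi r,
      {within `[0, +oo[, continuous phi},
      forall r s, 0 <= r -> r < s -> phi r < phi s,
      phi 0 = 0 &
      phi r @[r --> +oo] --> +oo].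

Definition duality_mapping {E : normedModType R} (phi : R -> R) (u : E) :
    set (E -> R^o) :=
  [set l : E -> R^o | [/\ dual l, opnorm l = phi `|u| &
               l u = opnorm l * `|u| ]].

Definition potential {E : normedModType R} (phi : R -> R) (u : E) : R^o :=
  \int[lebesgue_measure]_(t in `[0, `|u|]) phi t.

(* Only meant for J Gateaux differentiable: otherwise 'D_v J (u n) may be a
   default value. *)
Definition palais_smale {E : normedModType R} (J : E -> R^o) : Prop :=
  forall u : nat -> E,
    bounded_fun (J \o u) ->
    opnorm (gateaux_derivative J (u n)) @[n --> \oo] --> (0 : R) ->
    exists2 s : nat -> nat, increasing_seq s & cvgn (u \o s).

End Defs.

(* Main.v *)
Require Import Defs.
From mathcomp Require Import all_boot all_order all_algebra.
From mathcomp Require Import all_classical all_reals all_analysis.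
From HB Require Import structures.
From mathcomp Require Import ring lra.
Import Order.TTheory GRing.Theory Num.Theory.
Import numFieldNormedType.Exports.
Local Open Scope classical_set_scope.
Local Open Scope ring_scope.

(* Each derivative f'(x) is an isomorphism, so f is a local diffeomorphism.
   Moreover f is proper: if f(x_n) --> y, then h(x) = psi(f(x) - y) tends to 0 along
   (x_n), and as h >= 0, Ekeland's variational principle yields points z_n with
   |z_n - x_n| --> 0 and h'(z_n) --> 0; by the Palais-Smale condition (z_n), hence
   (x_n), has a convergent subsequence. A local section of a proper local
   homeomorphism extends along every segment issuing from its base point, and
   these extensions fit together to a global continuous section g. As X is
   connected, g o f = id by uniqueness of path lifting, so f is bijective. *)

(** Connectedness of the unit interval as an induction principle: let [c] be the supremum of the [t]
    up to which [P] holds throughout. The limit clause gives [P c], and the successor clause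
    excludes [c < 1]. *)
Lemma real_induction (R : realType) (P : R -> Prop) :
  P 0 ->
  (forall t, 0 <= t -> t < 1 -> P t ->
     exists2 e, 0 < e & forall s, t < s -> s < t + e -> s <= 1 -> P s) ->
  (forall t, 0 < t -> t <= 1 -> (forall s, 0 <= s -> s < t -> P s) -> P t) ->
  P 1.
Proof.
move=> P0 Popen Pclosed.
pose A := [set t : R | [/\ 0 <= t, t <= 1 & forall s, 0 <= s -> s <= t -> P s]].
have A0 : A 0.
  by split=> // s s0 s1; rewrite (_ : s = 0) //; apply/eqP; rewrite eq_le s1 s0.
have Aub : has_ubound A by exists 1 => t [].
set c := sup A.
have c0 : 0 <= c by exact: ub_le_sup.
have c1 : c <= 1 by apply: ge_sup; [exists 0|move=> t []].
have below s : 0 <= s -> s < c -> P s.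
  move=> s0 sc; have [||t At st] := @sup_adherent _ A (c - s); first by rewrite subr_gt0.
    by split => //; exists 0.
  move: st; rewrite subKr => st.
  by case: At => _ _; apply => //; exact: ltW.
have Pc : P c.
  by move: c0; rewrite le_eqVlt => /orP[/eqP <- //|c0]; exact: Pclosed.
move: c1; rewrite le_eqVlt => /orP[/eqP <- //|c1].
have [e e0 He] := Popen _ c0 c1 Pc.
pose d := Num.min (c + e / 2) 1.
have cd : c < d by rewrite /d lt_min c1 andbT; lra.
have dce : d < c + e by apply: le_lt_trans (_ : c + e / 2 < _); [rewrite /d ge_min lexx|lra].
suff : A d by move=> /(ub_le_sup Aub); rewrite leNgt cd.
split; first exact: le_trans c0 (ltW cd).
- by rewrite /d ge_min lexx orbT.
- move=> s s0 sd; case: (ltgtP s c) => [sc|cs|->//]; first exact: below.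
  apply: He => //; first exact: le_lt_trans dce.
  by apply: le_trans sd _; rewrite /d ge_min lexx orbT.
Qed.

Lemma continuous_ball (R : realType) (E F : normedModType R) (g : E -> F) z :
  {for z, continuous g} -> forall e : R, 0 < e -> exists2 d : R, 0 < d &
    forall w, `|w - z| < d -> `|g w - g z| < e.
Proof.
move=> gc e e0; have /cvgrPdist_lt/(_ e e0)/nbhs_normP[d /= d0 Hd] := gc.
by exists d => // w wz; rewrite distrC; apply: Hd; rewrite /ball_ /= distrC.
Qed.

(** * Bounds for the operator norm *)

Section opnorm.
Context {R : realType} {E F : normedModType R}.
Implicit Type L : E -> F.

(** A continuous linear map is bounded on the unit ball, so the supremum is a genuine upper bound
    there; homogeneity does the rest. *)
Lemma le_opnorm L h : linear L -> continuous L -> `|L h| <= opnorm L * `|h|.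
Proof.
move=> Llin Lcont.
pose L' := GRing.isLinear.Build R E F *:%R L Llin.
pose LL : {linear E -> F} := HB.pack L L'.
have [M M0 HM] : exists2 M, 0 < M & forall x, `|L x| <= M * `|x|.
  have /linear_boundedP : bounded_near LL (nbhs 0) by exact/linear_bounded_continuous.
  move=> HM; near (pinfty_nbhs R) => M; exists M; first by near: M; exact: nbhs_pinfty_gt.
  by near: M; exact: HM.
have hub : has_ubound [set `|L h| | h in [set h : E | `|h| <= 1]].
  exists M => _ [x /= x1 <-]; apply: le_trans (HM x) _.
  by rewrite ler_piMr // ltW.
have [->|h0] := eqVneq h 0.
  by rewrite -[L]/(LL : _ -> _) linear0 !normr0 mulr0.
have nh0 : 0 < `|h| by rewrite normr_gt0.
rewrite -ler_pdivrMr //; apply: ub_le_sup => //.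
exists (`|h|^-1 *: h) => /=.
  by rewrite normrZ normfV normr_id mulVf // gt_eqF.
by rewrite -[L]/(LL : _ -> _) linearZ normrZ normfV normr_id mulrC.
Unshelve. all: by end_near. Qed.

Lemma opnorm_bounds L c : 0 <= c -> (forall h, `|L h| <= c * `|h|) ->
  0 <= opnorm L <= c.
Proof.
move=> c0 Hc.
have ub : ubound [set `|L h| | h in [set h : E | `|h| <= 1]] c.
  by move=> _ [h /= h1 <-]; apply: le_trans (Hc h) _; rewrite ler_piMr.
have L0 : [set `|L h| | h in [set h : E | `|h| <= 1]] `|L 0|.
  by exists 0 => //=; rewrite normr0.
apply/andP; split; last by apply: ge_sup => //; exists `|L 0|.
by apply: le_trans (ub_le_sup _ L0); last by exists c.
Qed.
End opnorm.

(** * Mean value inequality *)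

Section mean_value.
Context {R : realType} {E F : normedModType R}.
Implicit Types (f : E -> F) (x v : E) (w : F).

Lemma derivable_expansion f x v : derivable f x v -> forall e, 0 < e ->
  exists2 d, 0 < d & forall s : R, `|s| < d ->
    `|f (x + s *: v) - f x - s *: 'D_v f x| <= e * `|s|.
Proof.
move=> /derivable_nbhs /eqaddoP fx e e0.
have /nbhs_normP[d /= d0 Hd] := fx e e0.
exists d => // s sd; have := Hd s; rewrite /ball_ /= sub0r normrN => /(_ sd).
by rewrite !fctE /= opprD addrA [s *: v + x]addrC.
Qed.

(** Real induction on [t] for the bound [(c + e) * t]; the slack [e] absorbs the first-order
    remainder at each parameter. *)
Lemma mean_value_le f x v w c :
  (forall t, 0 <= t <= 1 -> derivable f (x + t *: v) v) ->
  (forall t, 0 <= t <= 1 -> `|'D_v f (x + t *: v) - w| <= c) ->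
  `|f (x + v) - f x - w| <= c.
Proof.
move=> fd fc; apply/ler_addgt0Pr => e e0.
(* The estimate holds on both sides of [t]: [s > t] serves the successor clause, [s < t] the limit
   clause. *)
have step t : 0 <= t <= 1 -> exists2 d, 0 < d & forall s, `|s - t| < d ->
    `|f (x + s *: v) - f (x + t *: v) - (s - t) *: w| <= (c + e) * `|s - t|.
  move=> t01; have [d d0 Hd] := derivable_expansion _ _ _ (fd t t01) _ e0.
  exists d => // s /Hd; rewrite -[x + _ + _]addrA -scalerDl [t + _]addrC subrK => H.
  set D := 'D_v f _ in H.
  have -> : f (x + s *: v) - f (x + t *: v) - (s - t) *: w =
      (f (x + s *: v) - f (x + t *: v) - (s - t) *: D) + (s - t) *: (D - w).
    by rewrite scalerBr addrA subrK.
  rewrite (le_trans (ler_normD _ _))// normrZ mulrDl addrC lerD//.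
  by rewrite mulrC ler_wpM2r// fc.
pose P t := `|f (x + t *: v) - f x - t *: w| <= (c + e) * t.
have Pstep s t : P s -> s <= t ->
    `|f (x + t *: v) - f (x + s *: v) - (t - s) *: w| <= (c + e) * (t - s) -> P t.
  rewrite /P => Ps st H.
  have -> : f (x + t *: v) - f x - t *: w =
    (f (x + t *: v) - f (x + s *: v) - (t - s) *: w) + (f (x + s *: v) - f x - s *: w).
    by rewrite [RHS]addrACA [X in _ = X + _]addrA subrK -opprD -scalerDl subrK.
  rewrite (le_trans (ler_normD _ _))//.
  by apply: le_trans (lerD H Ps) _; rewrite -mulrDr subrK.
suff : P 1 by rewrite /P !scale1r mulr1.
apply: (real_induction _ P).
- by rewrite /P !scale0r addr0 subrr subr0 normr0 mulr0.
- move=> t t0 t1 Pt.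
  have [|d d0 Hd] := step t; first by rewrite t0 ltW.
  exists d => // s ts std _; apply: (Pstep t) => //; first exact: ltW.
  have st : `|s - t| = s - t by rewrite gtr0_norm // subr_gt0.
  by rewrite -{2}st; apply: Hd; rewrite st ltrBlDl.
- move=> t t0 t1 Pt.
  have [|d d0 Hd] := step t; first by rewrite t1 ltW.
  pose s := Num.max 0 (t - d / 2).
  have st : s < t by rewrite /s gt_max t0; lra.
  have sd : t - d < s by rewrite /s lt_max; apply/orP; right; lra.
  have s0 : 0 <= s by rewrite /s le_max lexx.
  apply: (Pstep s) (Pt _ s0 st) (ltW st) _.
  have ts : `|s - t| = t - s by rewrite distrC gtr0_norm // subr_gt0.
  rewrite -{2}ts; suff -> : f (x + t *: v) - f (x + s *: v) - (t - s) *: w =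
      - (f (x + s *: v) - f (x + t *: v) - (s - t) *: w).
    by rewrite normrN; apply: Hd; rewrite ts; lra.
  by rewrite opprD opprB opprK -scaleNr opprB.
Qed.
End mean_value.

(** * Epsilon-delta forms of differentiability *)

Section differentiability.
Context {R : realType} {E F : normedModType R}.
Implicit Types (f : E -> F) (x : E).

(** Trades the supremum for pointwise bounds, the form in which continuity of derivatives is used
    below; one direction rests on [le_opnorm], the other on [opnorm_bounds]. *)
Lemma opnorm_continuousP (D : E -> E -> F) :
  (forall x, linear (D x)) -> (forall x, continuous (D x)) ->
  opnorm_continuous D <->
  (forall x e, 0 < e -> exists2 d, 0 < d & forall z, `|z - x| < d ->
     forall v, `|D z v - D x v| <= e * `|v|).
Proof.
move=> Dl Dc; split=> H x.
- move=> e e0; have /cvgrPdist_le/(_ e e0)/nbhs_normP[d /= d0 Hd] := H x.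
  exists d => // z zx v; have := Hd z; rewrite /ball_ /= distrC => /(_ zx).
  rewrite sub0r normrN => /(le_trans (ler_norm _)) De.
  apply: le_trans (ler_wpM2r (normr_ge0 v) De).
  apply: (le_opnorm (fun v => D z v - D x v)).
    by move=> a u w; rewrite Dl (Dl x) scalerBr addrACA -opprD.
  by move=> u; apply: cvgB; [exact: Dc|exact: Dc].
- apply/cvgrPdist_le => e e0; have [d d0 Hd] := H x e e0.
  apply/nbhs_normP; exists d => //= z; rewrite /ball_ /= distrC => zx.
  have /andP[ge0 lee] := opnorm_bounds _ _ (ltW e0) (Hd z zx).
  by rewrite sub0r normrN ger0_norm.
Qed.

Lemma differentiable_expansion f x : differentiable f x -> forall e, 0 < e ->
  exists2 d, 0 < d & forall v, `|v| < d ->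
    `|f (x + v) - f x - 'd f x v| <= e * `|v|.
Proof.
move=> /diff_locally /eqaddoP fx e e0.
have /nbhs_normP[d /= d0 Hd] := fx e e0.
exists d => // v vd; have := Hd v; rewrite /ball_ /= sub0r normrN => /(_ vd).
by rewrite !fctE /= opprD addrA [v + x]addrC.
Qed.

Lemma differentiable_of_expansion f x (L : E -> F) : linear L -> continuous L ->
  (forall e, 0 < e -> exists2 d, 0 < d & forall v, `|v| < d ->
    `|f (x + v) - f x - L v| <= e * `|v|) ->
  differentiable f x /\ 'd f x = L :> (E -> F).
Proof.
move=> Llin Lcont H.
pose L' := GRing.isLinear.Build R E F *:%R L Llin.
pose LL : {linear E -> F} := HB.pack L L'.
have fE : f \o shift x = cst (f x) + LL +o_ (0 : E) id.
  apply/eqaddoP => e e0; have [d d0 Hd] := H e e0.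
  apply/nbhs_normP; exists d => //= v; rewrite /ball_ /= sub0r normrN => vd.
  by rewrite !fctE /= opprD addrA [v + x]addrC; exact: Hd.
have dL : 'd f x = L :> (E -> F) by exact: (@diff_unique _ _ _ f LL x).
split=> //; apply/diff_locallyP; rewrite dL; split => //.
Qed.

(** Mean value inequality from [x] to [x + v], with [w] the Gateaux derivative at [x] along [v]:
    continuity of the derivative keeps the error below [e] times the norm of [v]. *)
Lemma continuously_gateaux_differentiable_differentiable f :
  continuously_gateaux_differentiable f -> forall x, differentiable f x.
Proof.
move=> [fg fc] x.
have fl z : linear (gateaux_derivative f z) by case: (fg z).
have fz z : continuous (gateaux_derivative f z) by case: (fg z).
have {}fc := (opnorm_continuousP _ fl fz).1 fc x.
suff [] : differentiable f x /\ 'd f x = gateaux_derivative f x :> (E -> F) by [].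
apply: differentiable_of_expansion => // e e0.
have [d d0 Hd] := fc e e0; exists d => // v vd.
apply: mean_value_le => t /andP[t0 t1]; first by case: (fg (x + t *: v)).
apply: Hd; rewrite addrC addKr normrZ ger0_norm //.
by apply: le_lt_trans vd; rewrite ler_piMl.
Qed.

End differentiability.

(** * Ekeland's variational principle *)

(** [S x] collects the points that improve on [x] at rate [d]. Nearly minimising [F] over [S (u n)]
    at each step makes these sets nested with diameters tending to [0]; by completeness [u]
    converges, and its limit lies in all of them. *)
Lemma ekeland (R : realType) (X : completeNormedModType R) (F : X -> R)
    (d : R) (x0 : X) :
  continuous F -> (forall x, 0 <= F x) -> 0 < d ->
  exists2 z, F z + d * `|z - x0| <= F x0 &
             forall w, F z <= F w + d * `|w - z|.
Proof.
move=> Fc F0 d0; pose S x := [set z | F z + d * `|z - x| <= F x].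
have Sxx x : S x x by rewrite /S /= subrr normr0 mulr0 addr0.
have Strans x y z : S x y -> S y z -> S x z.
  rewrite /S /= => xy yz; apply: le_trans xy; apply: le_trans (lerD yz (lexx _)).
  by rewrite -addrA -mulrDr lerD2l ler_pM2l // ler_distD.
have next (xn : X * nat) : exists z, S xn.1 z /\
    forall w, S xn.1 w -> F z <= F w + xn.2.+1%:R^-1.
  case: xn => x n /=; have n0 : 0 < n.+1%:R^-1 :> R by rewrite invr_gt0.
  have infS : has_inf (F @` S x).
    by split; [exists (F x), x|exists 0 => _ [z _ <-]].
  have [_ [z Sz <-] zlt] := inf_adherent n0 infS.
  exists z; split=> // w Sw; apply: le_trans (ltW zlt) _.
  by rewrite lerD2r; apply: ge_inf; [case: infS|exists w].
have [g Hg] := choice next.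
pose u := fix u n := if n is m.+1 then g (u m, m) else x0.
have Smono n k : S (u n) (u (k + n)%N).
  elim: k => [|k IH] //=; apply: Strans IH _.
  by have [] := Hg (u (k + n)%N, (k + n)%N).
(* By transitivity [w] is in [S (u n)], where [u n.+1] is nearly minimal; this caps the decrease of
   [F] that membership in [S (u n.+1)] demands. *)
have Ssmall n w : S (u n.+1) w -> d * `|w - u n.+1| <= n.+1%:R^-1.
  move=> Sw; have [Su Hu] := Hg (u n, n).
  have uw : F (u n.+1) <= F w + n.+1%:R^-1 := Hu w (Strans _ _ _ Su Sw).
  have wu : F w + d * `|w - u n.+1| <= F (u n.+1) := Sw.
  by move: uw wu; set a := d * _; set b := F (u _); set c := _^-1; lra.
have small e : 0 < e -> exists n, d^-1 * n.+1%:R^-1 < e.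
  move=> e0; have [n _ Hn] := near_infty_natSinv_lt (PosNum (mulr_gt0 d0 e0)).
  by exists n; rewrite ltr_pdivrMl //; exact: (Hn n (leqnn n)).
have ucvg : cvgn u.
  apply/cauchy_cvgP/cauchy_exP => e e0; have [n ne] := small e e0.
  exists (u n.+1); exists n.+1 => // m /= nm; rewrite -ball_normE /ball_ /= distrC.
  apply: le_lt_trans ne; rewrite ler_pdivlMl //; apply: Ssmall.
  by rewrite -(subnK nm); exact: Smono.
pose z := lim (u @ \oo).
have Sz n : S (u n) z.
  have cv : F (u m) + d * `|u m - u n| @[m --> \oo] --> F z + d * `|z - u n|.
    apply: cvgD; first by apply: continuous_cvg; [exact: Fc|exact: ucvg].
    by apply: cvgMl_tmp; apply: cvg_norm; apply: cvgB; [exact: ucvg|exact: cvg_cst].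
  apply: (cvgr_to_le cv); exists n => // m /= nm.
  by rewrite -(subnK nm); exact: Smono.
exists z; first exact: (Sz 0%N).
(* A violating [w] lies in [S z], hence with [z] in every [S (u n.+1)]; as these shrink, [w = z],
   which contradicts the violation. *)
move=> w; rewrite leNgt; apply/negP => wz.
have Sw : S z w by exact: ltW.
suff wE : w = z by move: wz; rewrite wE subrr normr0 mulr0 addr0 ltxx.
apply/eqP; rewrite -subr_eq0 -normr_le0; apply/ler_addgt0Pr => e e0.
have [n ne] := small (e / 2) (divr_gt0 e0 (ltr0Sn _ 1)).
have Sn v : S (u n.+1) v -> `|v - u n.+1| <= e / 2.
  by move=> /Ssmall Hv; apply: le_trans (ltW ne); rewrite ler_pdivlMl.
rewrite add0r [leRHS]splitr (le_trans (ler_distD (u n.+1) _ _)) // lerD //.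
  by apply: Sn; exact: Strans Sw.
by rewrite distrC; exact: Sn.
Qed.

Lemma convex_ball_segment (R : realType) (E : normedModType R) (x a b : E) (r t : R) :
  `|a - x| < r -> `|b - x| < r -> 0 <= t <= 1 -> `|a + t *: (b - a) - x| < r.
Proof.
move=> ax bx /andP[t0 t1].
have -> : a + t *: (b - a) - x = (1 - t) *: (a - x) + t *: (b - x).
  by rewrite scalerBl scale1r -[RHS]addrA [- _ + _]addrC
    -scalerBr [- (a - x)]opprB subrKA [RHS]addrAC.
rewrite (le_lt_trans (ler_normD _ _)) // !normrZ !ger0_norm ?subr_ge0 //.
have [->|tn0] := eqVneq t 0; first by rewrite subr0 mul1r mul0r addr0.
have tp : 0 < t by rewrite lt_neqAle eq_sym tn0.
apply: (@le_lt_trans _ _ ((1 - t) * r + t * `|b - x|)).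
  by rewrite lerD2r ler_wpM2l ?subr_ge0 // ltW.
by rewrite -[ltRHS]mul1r -[in ltRHS](subrK t 1) [ltRHS]mulrDl ltrD2l ltr_pM2l.
Qed.

(** * Local inversion of a continuously differentiable map *)

Section local_inversion.
Context {R : realType} {X Y : completeNormedModType R}.
Variable f : X -> Y.
Hypothesis fC1 : is_C1 f.
Hypothesis fIsom : forall x, Isom ('d f x : X -> Y).

(** Near [x] the derivative moves by at most half of the constant in [Isom], which leaves the other
    half as a lower bound; the mean value inequality carries it over to differences of [f]. *)
Lemma C1_local_bounds x : exists a r : R, [/\ 0 < a, 0 < r,
  forall z h, `|z - x| < r -> a * `|h| <= `|'d f z h| &
  forall z z', `|z - x| < r -> `|z' - x| < r -> a * `|z' - z| <= `|f z' - f z|].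
Proof.
have [fd fc] := fC1.
have {}fc : forall x e, 0 < e -> exists2 d, 0 < d & forall z, `|z - x| < d ->
    forall v, `|'d f z v - 'd f x v| <= e * `|v|.
  apply/opnorm_continuousP => // z; first exact: linearP.
  exact: diff_continuous.
have [_ [a a0 Ha]] := fIsom x.
have [r r0 Hr] := fc x _ (divr_gt0 a0 (ltr0Sn _ 1)).
exists (a / 2), r; split=> //; first by rewrite divr_gt0.
- move=> z h /Hr/(_ h); have := Ha h.
  have := lerB_dist ('d f x h) ('d f x h - 'd f z h).
  by rewrite subKr distrC; lra.
- move=> z z' zx z'x; set v := z' - z.
  have : `|f (z + v) - f z - 'd f x v| <= a / 2 * `|v|.
    apply: mean_value_le => t t01; first exact: diff_derivable.
    by rewrite deriveE //; apply: Hr; exact: convex_ball_segment.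
  have := Ha v; rewrite [z + v]addrC subrK.
  have := lerB_dist ('d f x v) ('d f x v - (f z' - f z)).
  by rewrite subKr distrC; lra.
Qed.

Lemma C1_locally_injective x : exists2 r : R, 0 < r &
  forall z z', `|z - x| < r -> `|z' - x| < r -> f z = f z' -> z = z'.
Proof.
have [a [r [a0 r0 _ H]]] := C1_local_bounds x; exists r => // z z' zx z'x fzz.
apply/eqP; rewrite -subr_eq0 -normr_le0 -(pmulr_rle0 _ a0).
by apply: le_trans (H _ _ z'x zx) _; rewrite fzz subrr normr0.
Qed.

(* At an Ekeland point [z] of [|f - y|], moving along the preimage of [y - f z]
   under ['d f z] would decrease [|f - y|] too fast, unless [f z = y]. *)
Lemma C1_locally_open x (r : R) : 0 < r -> exists2 rho : R, 0 < rho &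
  forall y, `|y - f x| < rho -> exists2 z, `|z - x| < r & f z = y.
Proof.
move=> r0; have [fd _] := fC1.
have [a [r' [a0 r'0 Ha _]]] := C1_local_bounds x.
pose q := Num.min r r'; have q0 : 0 < q by rewrite lt_min r0.
have a2 : 0 < a / 2 by rewrite divr_gt0.
(* With slope [a / 2], the Ekeland point is at distance at most the norm of [y - f x] over [a / 2],
   hence less than [q], from [x]. *)
exists (a / 2 * q); first by rewrite mulr_gt0.
move=> y yx.
have Fc : continuous (fun z => `|f z - y|).
  move=> z; apply: cvg_norm; apply: cvgB; last exact: cvg_cst.
  by apply: differentiable_continuous.
have [z zx zmin] := ekeland _ _ _ _ x Fc (fun z => normr_ge0 _) a2.
have zq : `|z - x| < q.
  rewrite -(ltr_pM2l a2); apply: le_lt_trans yx; rewrite [leRHS]distrC.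
  by apply: le_trans zx; rewrite lerDr.
move: zq; rewrite lt_min => /andP[zr zr'].
exists z => //; have [v vE] := (fIsom z).1 (y - f z).
have av := Ha z v zr'; rewrite vE in av.
(* The error [a / 4] plus the slope [a / 2] stays below [a]; this gap forces [v = 0]. *)
have a4 : 0 < a / 4 by rewrite divr_gt0.
have [d d0 Hd] := differentiable_expansion _ _ (fd z) _ a4.
suff v0 : `|v| <= 0.
  move: v0 vE; rewrite normr_le0 => /eqP ->; rewrite linear0.
  by move/eqP; rewrite eq_sym subr_eq0 => /eqP.
(* [s] makes [s *: v] shorter than [d]; the added [1] keeps the denominator positive when
   [v = 0]. *)
pose s := Num.min 1 (d / (2 * (`|v| + 1))).
have v1 : 0 < 2 * (`|v| + 1) by rewrite mulr_gt0 // ltr_wpDl.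
have s0 : 0 < s by rewrite lt_min ltr01 divr_gt0.
have s1 : s <= 1 by rewrite ge_min lexx.
have nsv : `|s *: v| = s * `|v| by rewrite normrZ gtr0_norm.
have svd : `|s *: v| < d.
  rewrite nsv; apply: (@le_lt_trans _ _ (d / (2 * (`|v| + 1)) * `|v|)).
    by rewrite ler_wpM2r // ge_min lexx orbT.
  rewrite mulrAC ltr_pdivrMr // ltr_pM2l //.
  by have := normr_ge0 v; lra.
have := Hd _ svd; rewrite linearZ /= vE.
have := zmin (z + s *: v); rewrite [z + _ - z]addrC addKr nsv.
have -> : f z - y = - (y - f z) by rewrite opprB.
have -> : f (z + s *: v) - y =
    (f (z + s *: v) - f z - s *: (y - f z)) - (1 - s) *: (y - f z).
  by rewrite scalerBl scale1r opprB addrA subrK opprB addrA subrK.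
move=> H1 H2; have {H1} := le_trans H1 (lerD (ler_normB _ _) (lexx _)).
rewrite normrN normrZ [`|1 - s|]ger0_norm ?subr_ge0 //.
move: H2 av; set W := `|y - f z|; set N := `|v|.
set B := `|_ - _ - _| => H2 av H1.
have : s * W <= s * (3 / 4 * a * N) by lra.
rewrite ler_pM2l // => WN; rewrite -(pmulr_rle0 _ a0); lra.
Qed.

(** The derivative of [g] at [y] is [M y], the inverse of ['d f (g y)]: the expansion of [f] at
    [g y] is inverted, and its error is controlled because [g] is Lipschitz near [y]. *)
Lemma C1_inverse (g : Y -> X) : cancel f g -> cancel g f -> continuous g ->
  is_C1 g.
Proof.
move=> fg gf gc; have [fd fc] := fC1.
have {}fc : forall x e, 0 < e -> exists2 d, 0 < d & forall z, `|z - x| < d ->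
    forall v, `|'d f z v - 'd f x v| <= e * `|v|.
  apply/opnorm_continuousP => // z; first exact: linearP.
  exact: diff_continuous.
have gnear y (d : R) := continuous_ball _ _ _ g y (gc y) d.
have [M HM] : exists M : Y -> Y -> X, forall y w, 'd f (g y) (M y w) = w.
  have /choice[M HM] : forall yw : Y * Y, exists v, 'd f (g yw.1) v = yw.2.
    by move=> [y w]; exact: (fIsom (g y)).1.
  by exists (fun y w => M (y, w)) => y w; exact: (HM (y, w)).
have Mbound y w (a : R) : 0 < a -> (forall h, a * `|h| <= `|'d f (g y) h|) ->
    `|M y w| <= a^-1 * `|w|.
  by move=> a0 Ha; rewrite ler_pdivlMl //; apply: le_trans (Ha _) _; rewrite HM.
have Mlin y : linear (M y).
  move=> k u w; apply/eqP; rewrite -subr_eq0 -normr_le0.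
  have [_ [a a0 Ha]] := fIsom (g y); rewrite -(pmulr_rle0 _ a0).
  by apply: le_trans (Ha _) _; rewrite linearB linearP !HM subrr normr0.
have Mcont y : continuous (M y).
  pose M' := GRing.isLinear.Build R Y X *:%R (M y) (Mlin y).
  pose MM : {linear Y -> X} := HB.pack (M y) M'.
  apply: (@bounded_linear_continuous _ _ _ MM); apply/linear_boundedP.
  have [_ [a a0 Ha]] := fIsom (g y).
  near=> b => w; apply: le_trans (Mbound y w a a0 Ha) _.
  by rewrite ler_wpM2r.
have dg y : differentiable g y /\ 'd g y = M y :> (Y -> X).
  apply: differentiable_of_expansion => // e e0.
  have [a [r [a0 r0 Ha Hr]]] := C1_local_bounds (g y).
  (* One factor [a] pays for inverting ['d f (g y)], the other for replacing the norm of [v] by that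
     of [w]. *)
  have ea : 0 < a * e * a by rewrite !mulr_gt0.
  have [d d0 Hd] := differentiable_expansion _ _ (fd (g y)) _ ea.
  have [d' d'0 Hd'] := gnear y _ r0.
  have [d'' d''0 Hd''] := gnear y _ d0.
  exists (Num.min d' d''); first by rewrite lt_min d'0.
  move=> w; rewrite lt_min => /andP[wd' wd''].
  have yw : y + w - y = w by rewrite addrC addKr.
  set v := g (y + w) - g y.
  have vr : `|v| < r by apply: Hd'; rewrite yw.
  have vd : `|v| < d by apply: Hd''; rewrite yw.
  have gv : g y + v = g (y + w) by rewrite addrC subrK.
  have := Hd v vd; rewrite gv !gf yw => wv.
  have : a * `|v| <= `|w|.
    have := Hr (g y) (g (y + w)); rewrite subrr normr0 !gf yw; exact.
  have := Ha (g y) (v - M y w); rewrite subrr normr0 => /(_ r0).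
  rewrite linearB HM [`|'d f _ _ - _|]distrC => H1 H2.
  rewrite -(ler_pM2l a0); apply: (le_trans H1); apply: (le_trans wv).
  by rewrite -!mulrA !ler_pM2l.
split; first by move=> y; have [] := dg y.
apply/opnorm_continuousP.
- by move=> y; exact: linearP.
- by move=> y; apply: diff_continuous; have [] := dg y.
move=> y e e0; have [a [r [a0 r0 Ha _]]] := C1_local_bounds (g y).
have ea : 0 < a * e * a by rewrite !mulr_gt0.
have [d d0 Hd] := fc (g y) _ ea.
have [d' d'0 Hd'] := gnear y _ r0.
have [d'' d''0 Hd''] := gnear y _ d0.
exists (Num.min d' d''); first by rewrite lt_min d'0.
move=> y'; rewrite lt_min => /andP[yd' yd''] w.
rewrite (dg y).2 (dg y').2.
have := Mbound y' w a a0 (fun h => Ha _ h (Hd' _ yd')).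
rewrite ler_pdivlMl // => H1.
have := Ha (g y) (M y' w - M y w); rewrite subrr normr0 => /(_ r0).
rewrite linearB HM => H2.
(* Identity for a difference of inverses: ['d f (g y)] maps [M y' w - M y w] to
   ['d f (g y) (M y' w) - w], and [w] is ['d f (g y') (M y' w)]. *)
have {}H2 : a * `|M y' w - M y w| <= `|'d f (g y') (M y' w) - 'd f (g y) (M y' w)|.
  by rewrite HM [leRHS]distrC.
rewrite -(ler_pM2l a0); apply: (le_trans H2); apply: (le_trans (Hd _ (Hd'' _ yd'') _)).
by rewrite -!mulrA !ler_pM2l.
Unshelve. all: by end_near. Qed.
End local_inversion.

(** * Properness from the Palais-Smale condition *)

Lemma increasing_seq_cvg_infty (s : nat -> nat) :
  increasing_seq s -> s n @[n --> \oo] --> \oo.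
Proof.
move=> /increasing_seqP sinc A [N _ NA].
have sn n : (n <= s n)%N by elim: n => // n /leq_ltn_trans; apply; exact: sinc.
by exists N => // n /= Nn; apply: NA; exact: leq_trans (sn n).
Qed.

Section palais_smale_properness.
Context {R : realType} {X : completeNormedModType R} {Y : normedModType R}.

(** Testing minimality at [z + s *: v] and [z - s *: v] for a small [s > 0] bounds the derivative
    from both sides. *)
Lemma derive_le_slope (E : normedModType R) (J : E -> R^o) (z v : E) (d : R) :
  (forall w, J z <= J w + d * `|w - z|) -> derivable J z v ->
  `|'D_v J z| <= d * `|v|.
Proof.
move=> Jz Jv; apply/ler_addgt0Pr => e e0.
have [r r0 Hr] := derivable_expansion _ _ _ Jv _ e0.
have [s s0 sr] : exists2 s : R, 0 < s & s < r by exists (r / 2); lra.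
have sn : `|s| = s by rewrite gtr0_norm.
have := Hr s; have := Hr (- s); rewrite normrN sn => /(_ sr) + /(_ sr).
have := Jz (z + s *: v); have := Jz (z + (- s) *: v).
rewrite ![z + _ - z]addrC !addKr !normrZ normrN sn.
set D : R := 'D_v J z => H1 H2; rewrite !ler_norml => /andP[_ H3] /andP[H4 H5].
have atoms (a b c p D' : R) : c <= b + d * (s * p) -> c <= a + d * (s * p) ->
    b - c - - s * D' <= e * s -> a - c - s * D' <= e * s ->
    - (d * p + e) <= D' <= d * p + e.
  move=> h1 h2 h3 h4; apply/andP.
  by split; rewrite -(ler_pM2l s0) ?mulrN !mulrDr; lra.
exact: atoms H1 H2 H3 H5.
Qed.

(* Ekeland's principle moves [u n] by at most [d n --> 0] to an almost critical
   point of [x |-> psi (f x - y)], so that the Palais-Smale condition applies. *)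
Lemma palais_smale_proper (psi : Y -> R^o) (f : X -> Y) (y : Y) (u : nat -> X) :
  psi 0 = 0 -> (forall v, 0 <= psi v) -> (forall v, differentiable psi v) ->
  (forall x, differentiable f x) ->
  palais_smale (fun x => psi (f x - y)) ->
  f (u n) @[n --> \oo] --> y ->
  exists2 s : nat -> nat, increasing_seq s & cvgn (u \o s).
Proof.
move=> psi0 psi_ge0 dpsi df PS fuy; pose J x : R^o := psi (f x - y).
have dJ x : differentiable J x.
  apply: (@differentiable_comp _ _ _ _ (fun x => f x - y) psi) => //.
  by apply: differentiableB => //; exact: differentiable_cst.
have Jc : continuous J by move=> x; exact: differentiable_continuous.
have J0 x : 0 <= J x by exact: psi_ge0.
have Ju : J (u n) @[n --> \oo] --> (0 : R).
  rewrite -psi0; apply: (@continuous_cvg _ _ _ _ _ _ psi).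
    exact: differentiable_continuous.
  by rewrite -(subrr y); apply: cvgB => //; exact: cvg_cst.
(* The square root makes [d n * d n] at least [J (u n)], so the Ekeland point is within [d n] of
   [u n]; the harmonic term keeps [d n] positive when [J (u n) = 0]. *)
pose d n : R := Num.sqrt (J (u n)) + n.+1%:R^-1.
have n0 n : 0 < n.+1%:R^-1 :> R by rewrite invr_gt0.
have d0 n : 0 < d n by rewrite /d ltr_wpDl ?sqrtr_ge0.
have /choice[z Hz] : forall n, exists z, J z + d n * `|z - u n| <= J (u n) /\
    forall w, J z <= J w + d n * `|w - z|.
  by move=> n; have [z zu zw] := ekeland _ _ J _ (u n) Jc J0 (d0 n); exists z.
have d_cvg : d n @[n --> \oo] --> (0 : R).
  rewrite -[0 : R]addr0 -{1}(sqrtr0 R); apply: cvgD.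
    by apply: continuous_cvg => //; exact: sqrt_continuous.
  exact: cvg_harmonic.
have zu n : `|z n - u n| <= d n.
  have [zun _] := Hz n; rewrite -(ler_pM2l (d0 n)).
  have : d n * `|z n - u n| <= Num.sqrt (J (u n)) ^+ 2.
    by rewrite sqr_sqrtr //; apply: le_trans zun; rewrite lerDr.
  move=> /le_trans; apply; rewrite -expr2 ler_sqr ?nnegrE ?sqrtr_ge0 ?ltW //.
  by rewrite /d ltrDl.
have [||s sinc zs] := PS z.
- have [M [_ HM]] := cvg_seq_bounded (cvgP _ Ju).
  exists (M + 1); split; first exact: num_real.
  move=> b Mb n _ /=; rewrite ger0_norm ?J0 //.
  apply: (@le_trans _ _ (J (u n))); last first.
    apply: le_trans (ler_norm _) _; apply: (HM _ _ n) => //.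
    by apply: lt_trans Mb; rewrite ltrDl.
  by apply: le_trans (Hz n).1; rewrite lerDl mulr_ge0 // ltW.
- have opb n : 0 <= opnorm (gateaux_derivative J (z n)) <= d n.
    apply: opnorm_bounds; first exact: ltW.
    move=> v; apply: derive_le_slope; first exact: (Hz n).2.
    exact: diff_derivable.
  by apply: (squeeze_cvgr _ (cvg_cst 0) d_cvg); near=> n; exact: opb.
(* The limit is written as a difference because [u] is [z] minus the vanishing displacement
   [z - u]. *)
exists s => //; apply/cvg_ex; exists (lim (z \o s @ \oo) - 0).
have -> : u \o s = (fun n => z (s n) - (z (s n) - u (s n))).
  by apply/funext => n /=; rewrite subKr.
apply: cvgB; first exact: zs.
apply: (cvg_comp s (fun n => z n - u n) (increasing_seq_cvg_infty s sinc)).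
apply/norm_cvg0P; apply: (squeeze_cvgr _ (cvg_cst 0) d_cvg).
by near=> n; rewrite normr_ge0 zu.
Unshelve. all: by end_near. Qed.
End palais_smale_properness.

(** * Elementary properties of the potential *)

Section potential.
Context {R : realType} {E : normedModType R} (phi : R -> R).

Lemma potential0 : potential phi (0 : E) = 0.
Proof. by rewrite /potential normr0 set_itv1 Rintegral_set1. Qed.

Lemma potential_ge0 (u : E) : normalization_function phi -> 0 <= potential phi u.
Proof.
case=> phi_ge0 _ _ _ _; apply: Rintegral_ge0 => t /=.
by rewrite in_itv /= => /andP[t0 _]; exact: phi_ge0.
Qed.
End potential.

(** * Global inversion of a proper local homeomorphism *)

Section proper_local_homeomorphism.
Context {R : realType} {X Y : normedModType R}.
Variable f : X -> Y.
Hypothesis f_continuous : continuous f.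
Hypothesis f_locally_injective : forall x, exists2 r : R, 0 < r &
  forall z z', `|z - x| < r -> `|z' - x| < r -> f z = f z' -> z = z'.
Hypothesis f_locally_open : forall x (r : R), 0 < r -> exists2 rho : R, 0 < rho &
  forall y, `|y - f x| < rho -> exists2 z, `|z - x| < r & f z = y.
Hypothesis f_proper : forall (u : nat -> X) (y : Y), f (u n) @[n --> \oo] --> y ->
  exists2 s : nat -> nat, increasing_seq s & cvgn (u \o s).

(** Agreement extends to the right by local injectivity and passes to limits from the left by
    continuity, so real induction applies. *)
Lemma path_lift_unique (h h' : R -> X) :
  (forall t, 0 <= t <= 1 -> {for t, continuous h}) ->
  (forall t, 0 <= t <= 1 -> {for t, continuous h'}) ->
  (forall t, 0 <= t <= 1 -> f (h t) = f (h' t)) ->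
  h 0 = h' 0 -> h 1 = h' 1.
Proof.
move=> hc h'c fh h0; apply: (real_induction _ (fun t => h t = h' t)) => //.
- move=> t t0 t1 ht; have t01 : 0 <= t <= 1 by rewrite t0 ltW.
  have [r r0 Hr] := f_locally_injective (h t).
  have [d d0 Hd] := continuous_ball _ _ _ h t (hc t t01) r r0.
  have [d' d'0 Hd'] := continuous_ball _ _ _ h' t (h'c t t01) r r0.
  exists (Num.min d d'); first by rewrite lt_min d0.
  move=> s ts; rewrite -ltrBlDl lt_min => /andP[sd sd'] s1.
  have st : `|s - t| = s - t by rewrite gtr0_norm // subr_gt0.
  apply: Hr; first by apply: Hd; rewrite st.
    by rewrite ht; apply: Hd'; rewrite st.
  by apply: fh; rewrite s1 andbT (le_trans t0) // ltW.
- move=> t t0 t1 hs; have t01 : 0 <= t <= 1 by rewrite t1 ltW.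
  apply/eqP; rewrite -subr_eq0 -normr_le0; apply/ler_addgt0Pr => e e0.
  have e2 : 0 < e / 2 by rewrite divr_gt0.
  have [d d0 Hd] := continuous_ball _ _ _ h t (hc t t01) _ e2.
  have [d' d'0 Hd'] := continuous_ball _ _ _ h' t (h'c t t01) _ e2.
  have [s [s0 st sd sd']] : exists s, [/\ 0 <= s, s < t, t - s < d & t - s < d'].
    exists (Num.max 0 (t - Num.min d d' / 2)).
    have m0 : 0 < Num.min d d' by rewrite lt_min d0.
    have md : Num.min d d' <= d by rewrite ge_min lexx.
    have md' : Num.min d d' <= d' by rewrite ge_min lexx orbT.
    move: m0 md md'; set m := Num.min d d' => m0 md md'.
    have : t - m / 2 <= Num.max 0 (t - m / 2) by rewrite le_max lexx orbT.
    split; [by rewrite le_max lexx|by rewrite gt_max t0; lra|lra|lra].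
  have ts : `|s - t| = t - s by rewrite distrC gtr0_norm // subr_gt0.
  rewrite add0r [leRHS]splitr (le_trans (ler_distD (h s) _ _)) // lerD //.
    by rewrite distrC ltW //; apply: Hd; rewrite ts.
  by rewrite hs // ltW //; apply: Hd'; rewrite ts.
Qed.

Definition segment_convex (C : set Y) :=
  forall p q (t : R), C p -> C q -> 0 <= t <= 1 -> C (p + t *: (q - p)).

(** Continuity is that of [g] on all of [Y], not of its restriction to [C]; passing to a smaller set
    is then immediate. *)
Definition section_on (C : set Y) (g : Y -> X) :=
  forall y, C y -> f (g y) = y /\ {for y, continuous g}.

Lemma segment_path_continuous (E : normedModType R) (p v : E) :
  continuous (fun t : R => p + t *: v).
Proof.
by move=> t; apply: cvgD; [exact: cvg_cst|apply: cvgZr_tmp; exact: cvg_id].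
Qed.

(** Along the segment from [p] to [q], both sections lift the same path. *)
Lemma section_on_unique (C : set Y) (g g' : Y -> X) p q : segment_convex C ->
  section_on C g -> section_on C g' -> C p -> C q -> g p = g' p -> g q = g' q.
Proof.
move=> Cc gC g'C Cp Cq gp; pose z t := p + t *: (q - p).
have Cz t : 0 <= t <= 1 -> C (z t) by exact: Cc.
have z1 : z 1 = q by rewrite /z scale1r addrC subrK.
have z0 : z 0 = p by rewrite /z scale0r addr0.
rewrite -z1; apply: (path_lift_unique (g \o z) (g' \o z)).
- move=> t /Cz Ct; apply: continuous_comp; first exact: segment_path_continuous.
  exact: (gC _ Ct).2.
- move=> t /Cz Ct; apply: continuous_comp; first exact: segment_path_continuous.
  exact: (g'C _ Ct).2.
- by move=> t /Cz Ct /=; rewrite (gC _ Ct).1 (g'C _ Ct).1.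
- by rewrite /= z0.
Qed.

(** Local openness provides preimages in the injectivity ball, where they are unique; openness at
    [k y] with small radii then yields continuity of [k]. *)
Lemma local_section x : exists (rho r : R) (k : Y -> X), [/\ 0 < rho, 0 < r,
  section_on [set y | `|y - f x| < rho] k,
  forall y, `|y - f x| < rho -> `|k y - x| < r &
  forall z z', `|z - x| < r -> `|z' - x| < r -> f z = f z' -> z = z'].
Proof.
have [r r0 Hr] := f_locally_injective x.
have [rho rho0 Hrho] := f_locally_open x r r0.
have /choice[k Hk] : forall y, exists z, `|y - f x| < rho -> `|z - x| < r /\ f z = y.
  move=> y; have [/Hrho[z zx fz]|_] := boolP (`|y - f x| < rho); last by exists x.
  by exists z.
exists rho, r, k; split => // [y /= yx|y /Hk[]//].
have [kx fk] := Hk y yx; split => //.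
apply/cvgrPdist_lt => e e0.
(* The ball of radius [e'] around [k y] stays in the injectivity ball, so the preimage [z] found
   there must be [k y']. *)
pose e' := Num.min e (r - `|k y - x|).
have e'0 : 0 < e' by rewrite lt_min e0 subr_gt0.
have [d d0 Hd] := f_locally_open (k y) e' e'0.
apply/nbhs_normP; exists (Num.min d (rho - `|y - f x|)).
  by rewrite /= lt_min d0 subr_gt0.
move=> y'; rewrite /ball_ /= distrC lt_min => /andP[yd yrho].
have [|z] := Hd y'; first by rewrite fk.
rewrite lt_min => /andP[ze zr] fz.
have yr' : `|y' - f x| < rho.
  by rewrite (le_lt_trans (ler_distD y _ _)) // -ltrBrDr.
have [k'x fk'] := Hk y' yr'.
rewrite distrC (Hr (k y') z) ?fk' // (le_lt_trans (ler_distD (k y) _ _)) //.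
by rewrite -ltrBrDr.
Qed.

Lemma segment_convex_ball (y : Y) (r : R) :
  segment_convex [set z | `|z - y| < r].
Proof. by move=> p q t /= py qy t01; exact: convex_ball_segment. Qed.

Lemma open_norm_ball (E : normedModType R) (y : E) (r : R) :
  open [set z | `|z - y| < r].
Proof.
rewrite (_ : mkset _ = ball y r); first exact: ball_open.
by apply/seteqP; rewrite -ball_normE; split=> z; rewrite /ball_ /= distrC.
Qed.

Lemma section_on_eq_near (C : set Y) (g g' : Y -> X) y : open C -> C y ->
  (forall z, C z -> g z = g' z) -> {for y, continuous g'} -> {for y, continuous g}.
Proof.
move=> Co Cy gg' g'c; suff : g z @[z --> y] --> g y by [].
rewrite (gg' y Cy); apply: cvg_trans g'c; apply: near_eq_cvg.
by near do apply/esym/gg'; exact: open_nbhs_nbhs.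
Unshelve. all: by end_near. Qed.

(** Convexity and the prescribed value at [f a] make any two such sections agree on the overlap of
    their domains. *)
Definition section_reaches (a : X) (y : Y) := exists (C : set Y) (g : Y -> X),
  [/\ open C, segment_convex C, C (f a), C y & section_on C g /\ g (f a) = a].

(* Real induction along the segment from [f a] to [y]. At a limit parameter,
   properness provides a limit point [x] of the lifted segment; the local section
   through [x] then agrees with an earlier section on the (convex) intersection of
   their domains, and the two are glued on a convex tube around the segment. *)
Lemma section_reachesT a y : section_reaches a y.
Proof.
pose b := f a; pose p t := b + t *: (y - b).
have p0 : p 0 = b by rewrite /p scale0r addr0.
have p1 : p 1 = y by rewrite /p scale1r addrC subrK.
have pE s t : p s - p t = (s - t) *: (y - b).
  by rewrite /p opprD addrACA subrr add0r -scalerBl.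
have pB s t : `|p s - p t| = `|s - t| * `|y - b|.
  by rewrite pE normrZ.
have pc : continuous p by exact: segment_path_continuous.
rewrite -p1; apply: (real_induction _ (fun t => section_reaches a (p t))).
- rewrite p0; have [rho [r [k [rho0 r0 kS kr inj]]]] := local_section a.
  have bb : `|b - f a| < rho by rewrite subrr normr0.
  exists [set z | `|z - f a| < rho], k; split => //; last first.
    split=> //; apply: inj; [exact: kr|by rewrite subrr normr0|].
    exact: (kS _ bb).1.
  + exact: segment_convex_ball.
  + exact: open_norm_ball.
- move=> t t0 t1 [C [g [Co Cc Ca Ct gC]]].
  have /nbhs_normP[d /= d0 Hd] : nbhs t (p @^-1` C).
    by apply: pc; exact: open_nbhs_nbhs.
  exists d => // s ts std _; exists C, g; split=> //; apply: Hd.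
  by rewrite /ball_ /= distrC gtr0_norm ?subr_gt0 // ltrBlDl.
move=> t t0 t1 IH.
(* The shift by two puts every [s n] strictly between [0] and [t]; positivity is needed for the
   quotient [i / q] below. *)
pose s n : R := t - t * n.+2%:R^-1.
have sn n : 0 < s n < t.
  have n2 : 0 < n.+2%:R^-1 :> R by rewrite invr_gt0.
  rewrite /s subr_gt0 gtr_pMr // invf_lt1 // ltr1n /=.
  by rewrite gtrBl mulr_gt0.
have /choice[c Hc] : forall n, exists x, exists (C : set Y) (g : Y -> X),
    [/\ open C, segment_convex C, C b, C (p (s n)) &
      [/\ section_on C g, g b = a & g (p (s n)) = x]].
  move=> n; have /andP[s0 st] := sn n.
  have [C [g [Co Cc Ca Cs [gC ga]]]] := IH _ (ltW s0) st.
  by exists (g (p (s n))), C, g.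
have fc n : f (c n) = p (s n).
  by have [C [g [_ _ _ Cs [gC _ <-]]]] := Hc n; exact: (gC _ Cs).1.
have s_cvg : s n @[n --> \oo] --> t.
  rewrite -[X in _ --> X]subr0 -(mulr0 t); apply: cvgB; first exact: cvg_cst.
  apply: cvgMl_tmp; apply: (cvg_comp succn (@harmonic R) _ (@cvg_harmonic R)).
  exact: increasing_seq_cvg_infty.
have [|sg sginc /cvg_ex[x cx]] := f_proper c (p t).
  by under eq_fun do rewrite fc; apply: continuous_cvg => //; exact: pc.
have fx : f x = p t.
  have h1 : (f \o c \o sg) n @[n --> \oo] --> f x.
    by apply: continuous_cvg => //; exact: f_continuous.
  have h2 : (f \o c \o sg) n @[n --> \oo] --> p t.
    rewrite (_ : f \o c \o sg = (p \o s) \o sg); last first.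
      by apply/funext => n /=; exact: fc.
    apply: (cvg_comp sg (p \o s) (increasing_seq_cvg_infty _ sginc)).
    by apply: continuous_cvg => //; exact: pc.
  exact: (cvg_unique _ h1 h2).
have [rho [r [k [rho0 r0 kS kr inj]]]] := local_section x.
have [m [cmx cmy]] : exists m, `|c m - x| < r /\ `|p (s m) - p t| < rho / 2.
  have rho2 : 0 < rho / 2 by rewrite divr_gt0.
  have [N1 _ H1] := (cvgrPdist_lt _ _).1 cx r r0.
  have pst : p (s (sg n)) @[n --> \oo] --> p t.
    apply: continuous_cvg; first exact: pc.
    exact: (cvg_comp sg s (increasing_seq_cvg_infty _ sginc)).
  have [N2 _ H2] := (cvgrPdist_lt _ _).1 pst _ rho2.
  exists (sg (maxn N1 N2)); split; rewrite distrC.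
    by apply: H1; exact: leq_maxl.
  by apply: H2; exact: leq_maxr.
have [C [g [Co Cc Cb Cs [gC gb gs]]]] := Hc m.
move: (sn m) Cs gs cmy; set q := s m => /andP[q0 qt] Cq gq qy.
rewrite fx in kS kr.
have qrho : `|p q - p t| < rho by apply: lt_trans qy _; lra.
(* At [p q] both values lie in the injectivity ball of [x] over the same point; uniqueness of
   sections spreads the equality over the convex overlap. *)
have gk z : C z -> `|z - p t| < rho -> g z = k z.
  move=> Cz zt; pose D := C `&` [set z | `|z - p t| < rho].
  apply: (section_on_unique D _ _ (p q)) => //.
  - move=> u v i [/= Cu tu] [/= Cv tv] i01; split; first exact: Cc.
    exact: convex_ball_segment.
  - by move=> w [/= Cw _]; exact: gC.
  - by move=> w [/= _ tw]; exact: kS.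
  - rewrite gq; apply: inj => //; first exact: kr.
    by rewrite (kS _ qrho).1 fc.
(* A radius that fits in [C] at both ends of the segment from [b] to [p q]; by convexity the whole
   tube around it fits too. *)
have [d1 d10 Hd1] : exists2 d : R, 0 < d & forall e, `|e| < d -> C (b + e) /\ C (p q + e).
  have /nbhs_normP[d /= d0 Hd] : nbhs b C by exact: open_nbhs_nbhs.
  have /nbhs_normP[d' /= d'0 Hd'] : nbhs (p q) C by exact: open_nbhs_nbhs.
  exists (Num.min d d'); first by rewrite lt_min d0.
  move=> e; rewrite lt_min => /andP[ed ed']; split.
    by apply: Hd; rewrite /ball_ /= opprD addrA subrr sub0r normrN.
  by apply: Hd'; rewrite /ball_ /= opprD addrA subrr sub0r normrN.
(* Beyond [q] the path stays within [rho / 2] of [p t], so a tube of radius [rho / 2] there remains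
   in the domain of [k]. *)
pose d := Num.min d1 (rho / 2).
have d0 : 0 < d by rewrite lt_min d10 divr_gt0.
pose T := [set w : Y | exists2 i, 0 <= i <= t & `|w - p i| < d].
have Tsub w : T w -> C w \/ `|w - p t| < rho.
  move=> [i /andP[i0 it]]; rewrite lt_min => /andP[w1 w2].
  have [iq|qi] := leP i q.
    (* [w] lies at ratio [i / q] on the segment from [b] to [p q] translated by [w - p i]. *)
    left; have [Cb' Cq'] := Hd1 _ w1.
    have iq01 : 0 <= i / q <= 1.
      by rewrite divr_ge0 ?(ltW q0) //= ler_pdivrMr // mul1r.
    have := Cc _ _ _ Cb' Cq' iq01.
    suff -> : b + (w - p i) + (i / q) *: (p q + (w - p i) - (b + (w - p i))) = w by [].
    have -> : p q + (w - p i) - (b + (w - p i)) = q *: (y - b).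
      by rewrite [b + (w - _)]addrC addrKA /p addrC addKr.
    by rewrite scalerA divfK ?gt_eqF // addrAC -/(p i) addrC subrK.
  right; rewrite (le_lt_trans (ler_distD (p i) _ _)) //.
  rewrite [ltRHS]splitr ltrD // (le_lt_trans _ qy) // !pB ler_wpM2r //.
  rewrite [leLHS]distrC [leRHS]distrC !ger0_norm ?subr_ge0 //; lra.
pose g' z := if z \in C then g z else k z.
have g'C z : C z -> g' z = g z by move=> Cz; rewrite /g' mem_set.
have g'k z : `|z - p t| < rho -> g' z = k z.
  move=> zt; rewrite /g'; case: ifPn => // /set_mem Cz; exact: gk.
exists T, g'; split.
- rewrite openE => w [i i01 wi]; apply/nbhs_normP.
  exists (d - `|w - p i|); first by rewrite /= subr_gt0.
  move=> z; rewrite /ball_ /= distrC => zw; exists i => //.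
  by rewrite (le_lt_trans (ler_distD w _ _)) // -ltrBrDr.
(* As [p] is affine, the parameters and the offsets [u - p i], [v - p i'] can be combined with the
   same weights. *)
- move=> u v j [i /andP[i0 it] ui] [i' /andP[i'0 i't] vi] j01.
  have /andP[j0 j1] := j01.
  exists (i + j * (i' - i)).
    have h1 : 0 <= (1 - j) * i + j * i' by rewrite addr_ge0 ?mulr_ge0 ?subr_ge0.
    have h2 : 0 <= (1 - j) * (t - i) + j * (t - i').
      by rewrite addr_ge0 ?mulr_ge0 ?subr_ge0.
    by apply/andP; split; lra.
  have := convex_ball_segment _ _ 0 (u - p i) (v - p i') d j.
  rewrite !subr0 => /(_ ui vi j01).
  have -> : v - p i' - (u - p i) = (v - u) - (p i' - p i).
    by rewrite !opprB addrACA [RHS]addrACA [- p i' + _]addrC.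
  suff -> : p (i + j * (i' - i)) = p i + j *: (p i' - p i).
    by rewrite scalerBr addrACA -opprD.
  by rewrite pE scalerA -addrA -scalerDl.
- by exists 0; rewrite ?lexx ?ltW // p0 subrr normr0.
- by exists t; rewrite ?lexx ?ltW // subrr normr0.
- split; last by rewrite g'C.
  move=> w /Tsub[Cw|wt].
    split; first by rewrite g'C //; exact: (gC _ Cw).1.
    exact: (section_on_eq_near C g' g) Co Cw g'C (gC _ Cw).2.
  split; first by rewrite g'k //; exact: (kS _ wt).1.
  exact: (section_on_eq_near _ g' k) (open_norm_ball _ (p t) rho) wt g'k (kS _ wt).2.
Qed.

(** Sections based at [f 0] reach every [y] and agree on overlaps, so they assemble into [g]; near
    each point [g] coincides with one of them on an open set, hence is continuous. *)
Lemma proper_local_homeomorphism_inverse : exists g : Y -> X,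
  [/\ cancel f g, cancel g f & continuous g].
Proof.
have /choice[Cg HCg] : forall y, exists Cg : set Y * (Y -> X),
    [/\ open Cg.1, segment_convex Cg.1, Cg.1 (f 0), Cg.1 y &
      section_on Cg.1 Cg.2 /\ Cg.2 (f 0) = 0].
  by move=> y; have [C [g H]] := section_reachesT 0 y; exists (C, g).
pose g y := (Cg y).2 y.
have gE y z : (Cg y).1 z -> g z = (Cg y).2 z.
  move=> yz; have [_ yc y0 _ [yS ya]] := HCg y; have [_ zc z0 zz [zS za]] := HCg z.
  apply: (section_on_unique ((Cg y).1 `&` (Cg z).1) (Cg z).2 (Cg y).2 (f 0)) => //.
  - move=> u v i [yu zu] [yv zv] i01; split; [exact: yc|exact: zc].
  - by move=> w [_ zw]; exact: zS.
  - by move=> w [yw _]; exact: yS.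
  - by rewrite ya za.
have gf : cancel g f by move=> y; have [_ _ _ yy [yS _]] := HCg y; exact: (yS _ yy).1.
have gc : continuous g.
  move=> y; have [yo _ _ yy [yS _]] := HCg y.
  exact: (section_on_eq_near _ g (Cg y).2) yo yy (gE y) (yS _ yy).2.
exists g; split=> // x.
(* [x] becomes the endpoint of the segment [h] from [0], because [g \o f \o h] and [h] lift the same
   path from the same point. *)
have xE : 0 + 1 *: (x - 0) = x by rewrite scale1r subr0 add0r.
rewrite -[in LHS]xE -[RHS]xE.
pose h (t : R) := 0 + t *: (x - 0).
have hc : continuous h by exact: segment_path_continuous.
apply: (path_lift_unique (g \o f \o h) h).
- move=> t _; apply: continuous_comp; first exact: hc.
  by apply: continuous_comp; [exact: f_continuous|exact: gc].
- by move=> t _; exact: hc.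
- by move=> t _ /=; rewrite gf.
- rewrite /h /= scale0r addr0.
  by have [_ _ f0 _ [_ g0]] := HCg (f 0); rewrite (gE (f 0)).
Qed.
End proper_local_homeomorphism.

Theorem theorem3p11 (R : realType) (X Y : completeNormedModType R)
    (phi : R -> R) (hphi : normalization_function phi)
    (A : Y -> (Y -> R^o)) (hA : forall u : Y, duality_mapping phi u = [set A u])
    (hpsi : continuously_gateaux_differentiable (potential phi : Y -> R^o))
    (f : X -> Y) (hf : is_C1 f)
    (hPS : forall y : Y, palais_smale (fun x : X => potential phi (f x - y)))
    (hIsom : forall x : X, Isom ('d f x : X -> Y)) :
  diffeomorphism f.
Proof.
have [fd _] := hf.
(* Frechet differentiability of the potential allows the chain rule for its composition with
   [f x - y]. *)
have dpsi := continuously_gateaux_differentiable_differentiable _ hpsi.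
have [|||u y|g [fg gf gc]] := proper_local_homeomorphism_inverse f.
- by move=> x; exact: differentiable_continuous.
- exact: C1_locally_injective.
- exact: C1_locally_open.
- apply: (palais_smale_proper (potential phi)) => //; first exact: potential0.
  by move=> v; exact: potential_ge0.
by split=> //; exists g; split=> //; exact: (C1_inverse f).
Qed.
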